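(* Assume the different $\mathfrak{d}=(\delta)$ of $F$ is principal, and let $q\in\mathcal{O}$ be a product of prime elements. Then for all $\nu,\mu\in\mathcal{O}$, $$S(\delta^{-1}\nu,\delta^{-1}\mu;q)=\sum_{(d)\mid(\nu,\mu,q)}N((d))\,S\left(\delta^{-1},\delta^{-1}\frac{\nu\mu}{d^2};\frac{q}{d}\right),$$ where the sum runs over all principal ideals $(d)$ dividing the ideal $(\nu,\mu,q)=\nu\mathcal{O}+\mu\mathcal{O}+q\mathcal{O}$, and $d$ is any generator of $(d)$ (the summand does not depend on this choice).
   Context: $F$ is a totally real number field with ring of integers $\mathcal{O}$ and different $\mathfrak{d}$. A prime element is a generator of a nonzero prime ideal of $\mathcal{O}$; $N((d))$ is the absolute norm of the ideal $(d)$. $e(\nu)=\exp(2\pi i\,\mathrm{Tr}_{F/\mathbb{Q}}(\nu))$. For $\nu,\mu\in\mathfrak{d}^{-1}$ and nonzero $q\in\mathcal{O}$, $S(\nu,\mu;q)=\sum_{x\in(\mathcal{O}/q\mathcal{O})^\times}e\left(\frac{\nu x+\mu x^{-1}}{q}\right)$, where $xx^{-1}\equiv1\bmod q$. *)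

(* Defs.v *)
From HB Require Import structures.
From Stdlib Require Import Reals ClassicalEpsilon.
From mathcomp Require Import all_boot all_order all_algebra all_field.
From mathcomp Require Import Rstruct complex.

Set Implicit Arguments.
Unset Strict Implicit.
Unset Printing Implicit Defensive.

Import Order.TTheory GRing.Theory Num.Theory.
Local Open Scope ring_scope.

Notation C := (complex R).

Definition expQ (t : rat) : C :=
  Complex (cos (2%:R * PI * ratr t)) (sin (2%:R * PI * ratr t)).

Section NumberField.
Variable F : fieldExtType rat.

Definition totally_real : Prop :=
  forall (f : {rmorphism F -> algC}) (x : F), f x \is Num.real.

Definition inO (x : F) : Prop :=
  exists p : {poly int}, p \is monic /\ root (map_poly (fun z : int => z%:~R) p) x.

Definition dvdO (a b : F) : Prop := exists c, inO c /\ b = a * c.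

Definition trQ (x : F) : rat :=
  \tr (passmx.mxof (vbasis fullv) (vbasis fullv) (amull x)).

Definition eF (x : F) : C := expQ (trQ x).

(* delta generates the different: the inverse different (codifferent)
   { x in F | Tr(x O) subset Z } equals delta^{-1} O. *)
Definition different_generator (delta : F) : Prop :=
  forall x : F, (forall y, inO y -> trQ (x * y) \is a Num.int) <-> inO (delta * x).

Definition prime_elt (p : F) : Prop :=
  [/\ inO p, p != 0, ~ dvdO p 1 &
      forall a b, inO a -> inO b -> dvdO p (a * b) -> dvdO p a \/ dvdO p b].

Definition unit_mod (q x : F) : Prop :=
  inO x /\ exists y, inO y /\ dvdO q (x * y - 1).

Definition complete_res_sys (q : F) (r : seq F) : Prop :=
  [/\ uniq r, forall x, x \in r -> inO x,
      forall x y, x \in r -> y \in r -> dvdO q (x - y) -> x = y &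
      forall x, inO x -> exists2 y, y \in r & dvdO q (x - y)].

Definition reduced_res_sys (q : F) (r : seq F) : Prop :=
  [/\ uniq r, forall x, x \in r -> unit_mod q x,
      forall x y, x \in r -> y \in r -> dvdO q (x - y) -> x = y &
      forall x, unit_mod q x -> exists2 y, y \in r & dvdO q (x - y)].

Definition crs_of (q : F) : seq F := epsilon (inhabits [::]) (complete_res_sys q).
Definition rrs_of (q : F) : seq F := epsilon (inhabits [::]) (reduced_res_sys q).

Definition inv_mod (q x : F) : F :=
  epsilon (inhabits 0) (fun y => inO y /\ dvdO q (x * y - 1)).

Definition absnorm (d : F) : nat := size (crs_of d).

Definition kloosterman (nu mu q : F) : C :=
  \sum_(x <- rrs_of q) eF ((nu * x + mu * inv_mod q x) / q).

(* D lists exactly one generator of each principal ideal (d) containing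
   the ideal (nu, mu, q) = nu O + mu O + q O, i.e. dividing it. *)
Definition common_div_sys (nu mu q : F) (D : seq F) : Prop :=
  [/\ uniq D,
      forall d, d \in D -> [/\ inO d, dvdO d nu, dvdO d mu & dvdO d q],
      forall d d', d \in D -> d' \in D -> dvdO d d' -> dvdO d' d -> d = d' &
      forall d, inO d -> dvdO d nu -> dvdO d mu -> dvdO d q ->
        exists2 d', d' \in D & dvdO d d' /\ dvdO d' d].

Definition common_divs (nu mu q : F) : seq F :=
  epsilon (inhabits [::]) (common_div_sys nu mu q).

End NumberField.

(* Main.v *)
Require Import Defs.
From HB Require Import structures.
From Stdlib Require Import Reals ClassicalEpsilon.
From mathcomp Require Import all_boot all_order all_algebra all_field.
From mathcomp Require Import boolp Rstruct complex ring lra.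

(* Write psi_q (x) for the character e(x / (delta q)) of O / q, which is
   primitive because delta generates the different. The Kloosterman sum is the
   sum of psi_q (nu x + mu y) over the pairs x y = 1 mod q. Detecting the
   condition x y = 1 by the sum of psi_q (t (1 - x y)) over all t mod q and
   summing over x first turns it into the sum over t of
     G(t) = sum of psi_q (mu y + t) over the y mod q with t y = nu.
   Since q is a product of primes, each t is d u with d | q and u invertible
   modulo q / d, and d is unique up to units. The congruence d u y = nu mod q
   is solvable only if d | nu, its solutions form one class modulo q / d, and
   the sum over the lifts of this class vanishes unless d | mu, in which case
     G(d u) = N(d) psi_(q/d) (u + nu mu d^-2 u^-1). *)

Set Implicit Arguments.
Unset Strict Implicit.
Unset Printing Implicit Defensive.

Import Order.TTheory GRing.Theory Num.Theory.
Local Open Scope ring_scope.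

(** * Algebraic integers and divisibility *)

Section IntegerRing.
Variable F : fieldExtType rat.
Implicit Types a b c d x y : F.

Lemma inO_integralOver x : inO x <-> integralOver (intr : int -> F) x.
Proof. by split=> [[p [mp rp]]|[p mp rp]]; exists p. Qed.

Lemma inO0 : inO (0 : F).
Proof. exact/inO_integralOver/integral0. Qed.

Lemma inO1 : inO (1 : F).
Proof. exact/inO_integralOver/integral1. Qed.

Lemma inO_int (m : int) : inO (m%:~R : F).
Proof. exact/inO_integralOver/integral_id. Qed.

Lemma inOD x y : inO x -> inO y -> inO (x + y).
Proof. by rewrite !inO_integralOver; exact: integral_add. Qed.

Lemma inON x : inO x -> inO (- x).
Proof. by rewrite !inO_integralOver; exact: integral_opp. Qed.

Lemma inOB x y : inO x -> inO y -> inO (x - y).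
Proof. by rewrite !inO_integralOver; exact: integral_sub. Qed.

Lemma inOM x y : inO x -> inO y -> inO (x * y).
Proof. by rewrite !inO_integralOver; exact: integral_mul. Qed.

Lemma inO_sum (I : Type) (r : seq I) (P : pred I) (f : I -> F) :
  (forall i, P i -> inO (f i)) -> inO (\sum_(i <- r | P i) f i).
Proof. by move=> h; elim/big_ind: _ => //; [exact: inO0|exact: inOD]. Qed.

Lemma dvdO_refl a : dvdO a a.
Proof. by exists 1; split; [exact: inO1|rewrite mulr1]. Qed.

Lemma dvdO0 a : dvdO a 0.
Proof. by exists 0; split; [exact: inO0|rewrite mulr0]. Qed.

Lemma dvdO_mulr a c : inO c -> dvdO a (a * c).
Proof. by exists c. Qed.

Lemma dvdO_mull a c : inO c -> dvdO a (c * a).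
Proof. by move=> ?; rewrite mulrC; exact: dvdO_mulr. Qed.

Lemma dvdO_trans b a c : dvdO a b -> dvdO b c -> dvdO a c.
Proof.
by move=> [u [Ou ->]] [v [Ov ->]]; exists (u * v); rewrite mulrA; split=> //; exact: inOM.
Qed.

Lemma dvdOD a b c : dvdO a b -> dvdO a c -> dvdO a (b + c).
Proof.
by move=> [u [Ou ->]] [v [Ov ->]]; exists (u + v); rewrite mulrDr; split=> //; exact: inOD.
Qed.

Lemma dvdON a b : dvdO a b -> dvdO a (- b).
Proof. by move=> [u [Ou ->]]; exists (- u); rewrite mulrN; split=> //; exact: inON. Qed.

Lemma dvdOB a b c : dvdO a b -> dvdO a c -> dvdO a (b - c).
Proof. by move=> ab /dvdON; exact: dvdOD. Qed.

Lemma dvdOBC a b c : dvdO a (b - c) -> dvdO a (c - b).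
Proof. by move/dvdON; rewrite opprB. Qed.

Lemma dvdOMr a b c : dvdO a b -> inO c -> dvdO a (b * c).
Proof. by move=> ab Oc; apply: dvdO_trans ab _; exact: dvdO_mulr. Qed.

Lemma dvdOMl a b c : dvdO a b -> inO c -> dvdO a (c * b).
Proof. by rewrite mulrC; exact: dvdOMr. Qed.

Lemma dvdO_div a b : a != 0 -> dvdO a b <-> inO (b / a).
Proof.
move=> a0; split=> [[c [Oc ->]]|Oba]; first by rewrite mulrC mulKf.
by exists (b / a); split=> //; rewrite mulrC divfK.
Qed.

Lemma dvdO_mul2l c a b : c != 0 -> dvdO (c * a) (c * b) <-> dvdO a b.
Proof.
move=> c0; split=> [[e [Oe h]]|[e [Oe ->]]]; last by exists e; rewrite mulrA.
by exists e; split=> //; apply: (mulfI c0); rewrite h mulrA.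
Qed.

Lemma intrF_eq0 (m : int) : (m%:~R == 0 :> F) = (m == 0).
Proof. by rewrite -(rmorph_int (in_alg F)) fmorph_eq0 intr_eq0. Qed.

(** Clearing denominators in the minimal polynomial of [x] gives an integer polynomial [q] of degree
    [n]. If [a] is its leading coefficient, then [a ^+ n.-1 * q] becomes a monic integer polynomial
    in [a x]. *)
Lemma clear_denominator x : exists2 m : int, m != 0 & inO (m%:~R * x).
Proof.
have /polyOver1P[p Dp] := minPolyOver 1 x.
have [q [m m0 Dq]] := rat_poly_scale p.
have q0 : q != 0.
  apply/eqP => q0; move: (monic_neq0 (monic_minPoly 1 x)).
  by rewrite Dp Dq q0 rmorph0 scaler0 rmorph0 eqxx.
have rq : root (map_poly (intr : int -> F) q) x.
  have := root_minPoly 1 x; rewrite Dp Dq linearZ /= rootZ; last first.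
    by rewrite scaler_eq0 oner_eq0 orbF invr_eq0 intr_eq0.
  rewrite -map_poly_comp; congr (root _ x); apply: eq_map_poly => z /=.
  by rewrite -[RHS](rmorph_int (in_alg F)).
have sq : (1 < size q)%N.
  rewrite ltnNge; apply/negP => sq; move: rq; rewrite (size1_polyC sq) map_polyC rootC.
  by rewrite intrF_eq0 => /eqP c0; move: q0; rewrite (size1_polyC sq) c0 eqxx.
pose n := (size q).-1; have Dn : size q = n.+1 by rewrite /n prednK // ltnW.
have n0 : (0 < n)%N by rewrite -ltnS -Dn.
pose a := lead_coef q; exists a; first by rewrite lead_coef_eq0.
(* The coefficients are chosen so that [r] at [a x] equals [a ^+ n.-1] times [q] at [x]. *)
pose r : {poly int} := 'X^n + \poly_(i < n) (q`_i * a ^+ (n.-1 - i)%N).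
exists r; split.
  by rewrite monicE lead_coefDl ?lead_coefXn // size_polyXn ltnS size_poly.
have -> : root (map_poly intr r) (a%:~R * x) =
  (a%:~R ^+ n.-1 * (map_poly (intr : int -> F) q).[x] == 0).
  rewrite /root; congr (_ == 0).
  rewrite rmorphD /= map_polyXn hornerD hornerXn.
  rewrite (@horner_coef_wide _ n); last first.
    by rewrite (leq_trans (size_poly _ _)) // size_poly.
  rewrite (@horner_coef_wide _ n.+1) ?size_map_poly_id0 ?Dn //; last first.
    by rewrite intrF_eq0 lead_coef_eq0.
  rewrite big_ord_recr /= mulrDr addrC; congr (_ + _); last first.
    rewrite coef_map /= -[q`_n]/(q`_(size q).-1) -/(lead_coef q) -/a exprMn mulrA.
    by rewrite -exprSr prednK.
  rewrite mulr_sumr; apply: eq_bigr => i _.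
  rewrite !coef_map coef_poly ltn_ord /= rmorphM rmorphXn /= exprMn.
  have -> : (n.-1 = (n.-1 - i) + i)%N by rewrite subnK // -ltnS prednK.
  by rewrite exprD addnK; ring.
by move/rootP: rq => ->; rewrite mulr0.
Qed.

Lemma common_denominator (I : finType) (f : I -> F) :
  exists2 m : int, m != 0 & forall i, inO (m%:~R * f i).
Proof.
have [g g0 Og] : exists2 g : I -> int, (forall i, g i != 0) & forall i, inO ((g i)%:~R * f i).
  have /choice[g hg] : forall i, exists m : int, m != 0 /\ inO (m%:~R * f i).
    by move=> i; have [m] := clear_denominator (f i); exists m.
  by exists g => i; case: (hg i).
exists (\prod_i g i); first by apply/prodf_neq0.
move=> i; rewrite (bigD1 i) //= rmorphM /= mulrC mulrA; apply: inOM (inO_int _).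
by rewrite mulrC.
Qed.

End IntegerRing.

(** The hypothesis says [p(M) = 0], with the powers of [M] written as iterated products. Over [algC]
    the trace is the sum of the eigenvalues, each of which is a root of [p] and hence an algebraic
    integer; a rational algebraic integer lies in Z. *)
Lemma trace_integral n (M : 'M[rat]_n) (p : {poly int}) : p \is monic ->
  \sum_(i < size p) (p`_i)%:~R *: iter i (mulmx M) 1%:M = 0 -> \tr M \is a Num.int.
Proof.
case: n M => [|n] M mp pM0; first by rewrite [M]flatmx0 mxtrace0.
rewrite -Cint_rat; apply: Cint_rat_Aint.
  exact: Crat_rat.
rewrite -trace_map_mx; set N := map_mx _ M.
have [r Dr] := closed_field_poly_normal (char_poly N).
move: Dr; rewrite (monicP (char_poly_monic _)) scale1r => Dr.
have sr : size r = n.+1.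
  by apply: succn_inj; rewrite -[RHS](size_char_poly N) Dr size_prod_XsubC.
have -> : \tr N = \sum_(z <- r) z.
  by apply: oppr_inj; rewrite -char_poly_trace // Dr -coefPn_prod_XsubC sr.
rewrite big_seq; apply: rpred_sum => z rz.
have /eigenvalueP[v vN v0] : eigenvalue N z.
  by rewrite eigenvalue_root_char Dr root_prod_XsubC.
have vNi i : v *m iter i (mulmx N) 1%:M = z ^+ i *: v.
  elim: i => [|i IH]; first by rewrite mulmx1 expr0 scale1r.
  by rewrite iterS mulmxA vN -scalemxAl IH scalerA exprS.
apply: (@root_monic_Aint (map_poly intr p)); last 2 first.
- exact: monic_map.
- by apply/polyOverP => i; rewrite coef_map /= intr_int.
have mapN i : map_mx (ratr : rat -> algC) (iter i (mulmx M) 1%:M) = iter i (mulmx N) 1%:M.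
  by elim: i => [|i IH]; rewrite ?map_mx1 // !iterS map_mxM IH.
move/(congr1 (fun X => v *m map_mx (ratr : rat -> algC) X)): pM0.
rewrite map_mx0 mulmx0 raddf_sum mulmx_sumr.
have vE (i : 'I_(size p)) : true ->
    v *m map_mx (ratr : rat -> algC) ((p`_i)%:~R *: iter i (mulmx M) 1%:M) =
    ((p`_i)%:~R * z ^+ i) *: v.
  by rewrite map_mxZ mapN -scalemxAr vNi scalerA rmorph_int.
rewrite (eq_bigr _ vE) -scaler_suml => /eqP; rewrite scaler_eq0 (negPf v0) orbF => /eqP pz0.
apply/rootP; rewrite -[RHS]pz0 (@horner_coef_wide _ (size p)) ?size_poly //.
by apply: eq_bigr => i _; rewrite coef_map.
Qed.

(** * Traces and finiteness of residue rings *)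

Section Transversal.
Variables (T K : eqType) (key : T -> K -> Prop) (E : T -> T -> Prop).
Hypothesis E_sym : forall x y, E x y -> E y x.

(** Go through the keys one at a time: if some [x0] in [P] has key [k], keep it and drop everything
    related to [x0]. All elements with key [k] are dropped, so the remaining keys cover what is
    left. *)
Lemma exists_transversal (r : seq K) (P : T -> Prop) :
  (forall x, P x -> exists2 k, k \in r & key x k) ->
  (forall x y k, P x -> P y -> key x k -> key y k -> E x y) ->
  exists D : seq T, [/\ uniq D, forall x, x \in D -> P x,
    forall x y, x \in D -> y \in D -> E x y -> x = y &
    forall x, P x -> exists2 y, y \in D & E x y].
Proof.
elim: r P => [|k r IH] P cover keyE; first by exists [::]; split=> // x /cover[].
have [[x0 [Px0 x0k]]|nox] := pselect (exists x, P x /\ key x k); last first.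
  apply: IH => // x Px; have [k' + kx] := cover _ Px.
  by rewrite inE => /predU1P[k'E|k'r]; [case: nox; exists x; rewrite -k'E|exists k'].
have [||D [uD DP Dinj Dcover]] := IH (fun x => P x /\ ~ E x x0).
- move=> x [Px nEx]; have [k' + kx] := cover _ Px.
  rewrite inE => /predU1P[k'E|k'r]; last by exists k'.
  by case: nEx; apply: (keyE _ _ k) => //; rewrite -k'E.
- by move=> x y k1 [Px _] [Py _]; exact: keyE.
exists (x0 :: D); split.
- rewrite /= uD andbT; apply/negP => /DP[_]; apply; exact: (keyE _ _ k).
- by move=> x; rewrite inE => /predU1P[->|/DP[]].
- move=> x y; rewrite !inE => /predU1P[->|xD] /predU1P[->|yD] Exy //.
  + by case: (DP _ yD) => _ []; exact: E_sym.
  + by case: (DP _ xD).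
  + exact: Dinj.
- move=> x Px; have [Exx0|nEx] := pselect (E x x0); first by exists x0; rewrite ?mem_head.
  by have [y yD Exy] := Dcover x (conj Px nEx); exists y; rewrite // inE yD orbT.
Qed.

End Transversal.

Section Trace.
Variable F : fieldExtType rat.
Implicit Types a b c d q x y nu mu : F.

Let e := vbasis {:F}.
Let e_basis : basis_of {:F} e := vbasisP _.

Fact trQ_is_scalar : scalar (@trQ F).
Proof.
move=> k x y.
by rewrite /trQ (linearP (@amull _ F)) passmx.mxof_linear mxtraceD mxtraceZ.
Qed.

HB.instance Definition _ := GRing.isSemilinear.Build rat F rat *%R (@trQ F)
  (GRing.semilinear_linear trQ_is_scalar).

Lemma trQ1 : trQ (1 : F) = (\dim {:F})%:R.
Proof. by rewrite /trQ amull1 passmx.mxof1 ?mxtrace1 ?(basis_free e_basis). Qed.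

Lemma dim_neq0 : (\dim {:F})%:R != 0 :> rat.
Proof.
rewrite pnatr_eq0 dimv_eq0; apply/eqP => F0.
by have := memvf (1 : F); rewrite F0 memv0 oner_eq0.
Qed.

(** Nondegeneracy of the trace form: for nonzero [x] the choice [y = x^-1] gives the trace of 1,
    which is the degree of [F]. *)
Lemma trQ_eq0 x : (forall y, trQ (x * y) = 0) -> x = 0.
Proof.
move=> tr0; apply/eqP/negPn/negP => x0.
by have := tr0 x^-1; rewrite divff // trQ1 => /eqP; rewrite (negPf dim_neq0).
Qed.

(** Multiplication by [x] is a rational matrix killed by the monic integer polynomial of [x], so
    [trace_integral] applies. *)
Lemma trQ_int x : inO x -> trQ x \is a Num.int.
Proof.
case=> p [mp px]; apply: trace_integral mp _.
have mxof_exp i :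
    iter i (mulmx (passmx.mxof e e (amull x))) 1%:M = passmx.mxof e e (amull (x ^+ i)).
  elim: i => [|i IH]; first by rewrite amull1 passmx.mxof1 ?(basis_free e_basis).
  by rewrite iterS IH exprSr amullM (passmx.mxof_comp e e e_basis).
pose L z := passmx.mxof e e (amull z).
have Llin : linear L by move=> k y z; rewrite /L (linearP (@amull _ F)) passmx.mxof_linear.
have L0 : L 0 = 0 by have := Llin (-1) 0 0; rewrite !scaler0 addr0 scaleN1r addNr.
have -> : \sum_(i < size p) (p`_i)%:~R *: iter i (mulmx (passmx.mxof e e (amull x))) 1%:M
    = L (\sum_(i < size p) (p`_i)%:~R *: x ^+ i).
  by apply: (big_rec2 (fun u v => u = L v)) => // i u v _ ->; rewrite Llin mxof_exp.
rewrite -[RHS]L0; congr L.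
rewrite -[RHS](rootP px) (@horner_coef_wide _ (size p)) ?size_poly //.
apply: eq_bigr => i _; rewrite coef_map /= -(rmorph_int (in_alg F)) /=.
by rewrite -scalerAl mul1r.
Qed.

(** The Gram matrix [A] of the trace form is invertible because the form is nondegenerate; the rows
    of its inverse are the coordinates of the dual basis. *)
Lemma exists_dual_basis : exists b b' : 'I_(\dim {:F}) -> F, forall x,
  x = \sum_j trQ (x * b j) *: b' j.
Proof.
pose n := \dim {:F}.
pose A := \matrix_(i < n, j < n) trQ (e`_i * e`_j).
have A_unit : A \in unitmx.
  rewrite -row_free_unit -kermx_eq0; apply/rowV0P => v /sub_kermxP vA.
  (* A row [v] with [v A = 0] is the coordinate row of an element whose product with every [y] has
     trace 0. *)
  apply/eqP; rewrite -(passmx.vecof_eq0 e_basis); apply/eqP/trQ_eq0 => y.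
  rewrite [y](coord_basis e_basis) ?memvf // mulr_sumr linear_sum big1 // => j _.
  rewrite -scalerAr linearZ /=.
  move/rowP: vA => /(_ j); rewrite !mxE => vA.
  rewrite /passmx.vecof mulr_suml linear_sum /= [X in _ * X](_ : _ = 0) ?mulr0 // -[RHS]vA.
  by apply: eq_bigr => i _; rewrite mxE -scalerAl linearZ.
exists (fun j => e`_j).
exists (fun j => \sum_i (invmx A) j i *: e`_i) => x.
have xA : passmx.rVof e x *m A = \row_j trQ (x * e`_j).
  apply/rowP => j; rewrite !mxE [x in RHS](coord_basis e_basis) ?memvf //.
  rewrite mulr_suml linear_sum; apply: eq_bigr => i _.
  by rewrite !mxE -scalerAl linearZ.
rewrite -[LHS](passmx.rVofK e_basis) -[X in passmx.vecof _ X](mulmxK A_unit) xA.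
rewrite /passmx.vecof.
under eq_bigr do rewrite mxE scaler_suml.
rewrite exchange_big; apply: eq_bigr => j _.
rewrite scaler_sumr; apply: eq_bigr => i _.
by rewrite mxE scalerA.
Qed.

Lemma dvdO_int q : inO q -> q != 0 -> exists2 m : int, m != 0 & dvdO q m%:~R.
Proof.
by move=> Oq q0; have [m m0 Om] := clear_denominator q^-1; exists m => //; apply/dvdO_div.
Qed.

(* Modulo [M], the class of [x] is determined by the traces of [x] against a basis. *)
Lemma exists_residue_key q : inO q -> q != 0 ->
  exists (K : finType) (key : F -> K),
    forall x y, inO x -> inO y -> key x = key y -> dvdO q (x - y).
Proof.
(* Here [q] divides the integer [M], the [m b_j] are integral, and so are the [D b'_j / m]. If the
   traces of [x] and [y] against the [m b_j] agree modulo [M D], then [x - y] is [M] times an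
   integral combination of the [D b'_j / m]. *)
move=> Oq q0; have [M M0 qM] := dvdO_int Oq q0.
have [b [b' bb']] := exists_dual_basis.
have [m m0 mb] := common_denominator b.
have [D D0 Db'] := common_denominator (fun j => (m%:~R)^-1 * b' j).
pose t x j := trQ (x * (m%:~R * b j)).
pose N := absz (M * D).
have N0 : (0 < N)%N by rewrite absz_gt0 mulf_neq0.
(* As [N] is positive, [N.-1.+1] is [N], in the successor form that [inord] requires. For integral
   [x] the floors are exact, since the traces are integers. *)
exists ({ffun 'I_(\dim {:F}) -> 'I_N.-1.+1} : finType).
exists (fun x => [ffun j => inord `|(Num.floor (t x j) %% N)%Z|%N]).
move=> x y Ox Oy /ffunP kxy; apply: dvdO_trans qM _.
have /choice[w hw] : forall j, exists w : int, t x j - t y j = (M * D * w)%:~R.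
  move=> j; move: (kxy j); rewrite !ffunE => /(congr1 val).
  have fN z : (`|(z %% N)%Z| < N.-1.+1)%N.
    by rewrite prednK // -ltz_nat (gez0_abs (modz_ge0 _ _)) ?ltz_pmod // -lt0n.
  rewrite /= !inordK // => /(congr1 Posz); rewrite !(gez0_abs (modz_ge0 _ _)) -?lt0n // => /eqP.
  rewrite eqz_mod_dvd => Ndvd.
  have /dvdzP[w Dw] : (M * D %| Num.floor (t x j) - Num.floor (t y j))%Z.
    by move: Ndvd; rewrite /N !dvdzE absz_id.
  exists w; rewrite mulrC -Dw rmorphB /=.
  by rewrite !floorK // trQ_int //; apply: inOM.
exists (\sum_j (w j)%:~R * (D%:~R * ((m%:~R)^-1 * b' j))); split.
  by apply: inO_sum => j _; apply: inOM (inO_int _ _) _.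
rewrite [LHS]bb' mulr_sumr; apply: eq_bigr => j _.
have -> : trQ ((x - y) * b j) = (m%:~R)^-1 * (t x j - t y j).
  rewrite /t -linearB -mulrBl /=.
  have -> : (x - y) * (m%:~R * b j) = m%:~R *: ((x - y) * b j).
    by rewrite -(rmorph_int (in_alg F)) /= -!scalerAl mul1r -scalerAr.
  by rewrite linearZ /= mulKf // intr_eq0.
rewrite hw -scalerA.
have -> u : u%:~R *: b' j = u%:~R * b' j.
  by rewrite -(rmorph_int (in_alg F)) /= -scalerAl mul1r.
have mF : (m%:~R : F) != 0 by rewrite intrF_eq0.
have -> u : (m%:~R : rat)^-1 *: u = (m%:~R : F)^-1 * u.
  by rewrite -[m%:~R in RHS](rmorph_int (in_alg F)) -fmorphV /= -scalerAl mul1r.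
by rewrite !rmorphM /=; field.
Qed.

(** The operator [epsilon] returns a genuine residue system once one exists, and the finitely many
    keys provide one. *)
Lemma crsP q : inO q -> q != 0 -> complete_res_sys q (crs_of q).
Proof.
move=> Oq q0; apply: epsilon_spec.
have [K [key keyP]] := exists_residue_key Oq q0.
have [|||r [? ? ? ?]] := @exists_transversal _ _ (fun x k => key x = k)
    (fun x y => dvdO q (x - y)) _ (enum K) (@inO F).
- by move=> x y; exact: dvdOBC.
- by move=> x _; exists (key x); rewrite ?mem_enum.
- by move=> x y k Ox Oy kx ky; apply: keyP; rewrite ?kx ?ky.
by exists r; split.
Qed.

Lemma rrsP q : inO q -> q != 0 -> reduced_res_sys q (rrs_of q).
Proof.
move=> Oq q0; apply: epsilon_spec.
have [K [key keyP]] := exists_residue_key Oq q0.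
have [|||r [? ? ? ?]] := @exists_transversal _ _ (fun x k => key x = k)
    (fun x y => dvdO q (x - y)) _ (enum K) (unit_mod q).
- by move=> x y; exact: dvdOBC.
- by move=> x _; exists (key x); rewrite ?mem_enum.
- by move=> x y k [Ox _] [Oy _] kx ky; apply: keyP; rewrite ?kx ?ky.
by exists r; split.
Qed.

(* Two divisors of [q] that are congruent modulo [q] divide each other. *)
Lemma common_divsP nu mu q : inO q -> q != 0 ->
  common_div_sys nu mu q (common_divs nu mu q).
Proof.
move=> Oq q0; apply: epsilon_spec.
have [K [key keyP]] := exists_residue_key Oq q0.
have [|||r [? rO rI rC]] := @exists_transversal _ _ (fun x k => key x = k)
    (fun x y => dvdO x y /\ dvdO y x) _ (enum K)
    (fun d => [/\ inO d, dvdO d nu, dvdO d mu & dvdO d q]).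
- by move=> x y [].
- by move=> x _; exists (key x); rewrite ?mem_enum.
- move=> x y k [Ox _ _ xq] [Oy _ _ yq] kx ky.
  have qxy : dvdO q (x - y) by apply: keyP; rewrite ?kx ?ky.
  split; [rewrite -[y](subKr x)|rewrite -[x](subrK y)].
    by apply: dvdOB (dvdO_refl _) _; exact: dvdO_trans qxy.
  by apply: dvdOD (dvdO_refl _); exact: dvdO_trans qxy.
exists r; split=> // [x y xr yr xy yx|d Od dnu dmu dq]; first exact: rI.
exact: rC.
Qed.

Lemma inv_modP q x : unit_mod q x -> inO (inv_mod q x) /\ dvdO q (x * inv_mod q x - 1).
Proof. by case=> _; exact: epsilon_spec. Qed.

End Trace.

(** * The exponential character *)

Lemma expQE t (x : R := 2%:R * PI * ratr t) : expQ t = Complex (cos x) (sin x).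
Proof. by rewrite /expQ !RealsE. Qed.

Lemma expQD s t : expQ (s + t) = expQ s * expQ t.
Proof.
rewrite !expQE rmorphD mulrDr; apply/eqP; rewrite eq_complex /=.
have /= -> := cos_plus (2%:R * PI * ratr s) (2%:R * PI * ratr t).
have /= -> := sin_plus (2%:R * PI * ratr s) (2%:R * PI * ratr t).
by rewrite !RealsE eqxx /= addrC eqxx.
Qed.

Lemma expQ0 : expQ 0 = 1.
Proof. by rewrite expQE rmorph0 mulr0 cos_0 sin_0. Qed.

Lemma expQ1 : expQ 1 = 1.
Proof. by rewrite expQE rmorph1 mulr1 cos_2PI sin_2PI. Qed.

Lemma expQ_int t : t \is a Num.int -> expQ t = 1.
Proof.
have expQn n : expQ n%:R = 1.
  by elim: n => [|n IH]; rewrite ?expQ0 // -natr1 expQD IH expQ1 mulr1.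
case/intrP=> -[n|n] ->; first exact: expQn.
by rewrite NegzE rmorphN -[LHS]mulr1 -(expQn n.+1) -expQD addNr expQ0.
Qed.

(** Replace [t] by its fractional part [f]. With [x = PI f], the equation
    [cos (2 x) = 1 - 2 (sin x)^2 = 1] forces [sin x = 0], which is impossible for [x] strictly
    between 0 and [PI]. *)
Lemma expQ_eq1 t : expQ t = 1 -> t \is a Num.int.
Proof.
set f := t - (Num.floor t)%:~R => t1.
have f1 : expQ f = 1 by rewrite /f expQD t1 mul1r expQ_int // rpredN intr_int.
have /andP[f_ge0 f_lt1] : 0 <= f < 1.
  by have /andP[] := floor_itv t; rewrite subr_ge0 ltrBlDl rmorphD => -> ->.
have [f0|f_neq0] := eqVneq f 0.
  by rewrite -[t](subrK (Num.floor t)%:~R) -/f f0 add0r intr_int.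
have f_gt0 : 0 < f by rewrite lt_neqAle eq_sym f_neq0.
pose x : R := PI * ratr f.
have PI0 : 0 < PI by apply/RltP; exact: PI_RGT_0.
have x_gt0 : Rlt 0 x by apply/RltP; rewrite mulr_gt0 // ltr0q.
have x_lt : Rlt x PI by apply/RltP; rewrite gtr_pMr // -(rmorph1 (@ratr R)) ltr_rat.
have sx := sin_gt_0 _ x_gt0 x_lt.
have : cos (Rmult (IZR 2) x) = 1.
  have -> : Rmult (IZR 2) x = 2%:R * PI * ratr f by rewrite /x !RealsE mulrA.
  by move/eqP: f1; rewrite expQE eq_complex => /andP[/eqP].
have /= -> := cos_2a_sin x.
move/RltP: sx; rewrite !RealsE => sx h.
have : sin x * sin x = 0 by move: h; rewrite -[nat_of_pos _]/2%N; lra.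
by move/eqP; rewrite mulf_eq0 orbb => /eqP s0; rewrite s0 ltxx in sx.
Qed.

(** Systems of representatives are chosen arbitrarily and are linked only by a relation such as
    congruence; sums are reindexed along such a relation whenever it is a one-to-one matching. *)
Lemma sum_matching (V : nmodType) (T T' : eqType) (E : T -> T' -> Prop) r r'
    (f : T -> V) (g : T' -> V) :
  uniq r -> uniq r' ->
  (forall x, x \in r -> exists2 y, y \in r' & E x y) ->
  (forall y, y \in r' -> exists2 x, x \in r & E x y) ->
  (forall x x' y, x \in r -> x' \in r -> y \in r' -> E x y -> E x' y -> x = x') ->
  (forall x y y', x \in r -> y \in r' -> y' \in r' -> E x y -> E x y' -> y = y') ->
  (forall x y, x \in r -> y \in r' -> E x y -> f x = g y) ->
  \sum_(x <- r) f x = \sum_(y <- r') g y.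
Proof.
elim: r r' => [|x r IH] r' ur ur' cov cov' inj inj' fg.
  case: r' cov' {ur' cov inj inj' fg} => [|y r'] cov'; first by rewrite !big_nil.
  by have [] := cov' y (mem_head _ _).
have xr0 : x \in x :: r by rewrite mem_head.
have mr z : z \in r -> z \in x :: r by rewrite inE orbC => ->.
case/andP: ur => xr ur.
have [y yr' Exy] := cov x xr0.
rewrite big_cons (perm_big _ (perm_to_rem yr')) big_cons /=.
have mrem z : (z \in rem y r') = (z != y) && (z \in r') by rewrite mem_rem_uniq.
congr (_ + _); first exact: fg.
apply: IH => //.
- exact: rem_uniq.
- move=> z zr; have [w wr' Ezw] := cov z (mr _ zr); exists w => //.
  rewrite mrem wr' andbT; apply: contra xr => /eqP wy.
  by rewrite (inj x z y xr0 (mr _ zr) yr' Exy) // -wy.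
- move=> w; rewrite mrem => /andP[wy wr']; have [z + Ezw] := cov' w wr'.
  rewrite inE => /predU1P[zx|zr]; last by exists z.
  by rewrite (inj' x w y xr0 wr' yr' _ Exy) ?eqxx // -?zx in wy.
- by move=> z z' w zr z'r; rewrite mrem => /andP[_ wr']; apply: inj => //; exact: mr.
- move=> z w w' zr; rewrite !mrem => /andP[_ wr'] /andP[_ w'r'].
  by apply: inj' => //; exact: mr.
- by move=> z w zr; rewrite mrem => /andP[_ wr']; apply: fg => //; exact: mr.
Qed.

(** * Residue systems and primes *)

Section Residues.
Variable F : fieldExtType rat.
Implicit Types a b d p q t u v x y z : F.

Lemma unit_mod_inO q x : unit_mod q x -> inO x.
Proof. by case. Qed.

Lemma inv_mod_unique q x y x' y' : inO y -> inO y' ->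
  dvdO q (x * y - 1) -> dvdO q (x' * y' - 1) -> dvdO q (x - x') -> dvdO q (y - y').
Proof.
move=> Oy Oy' xy xy' xx'.
have -> : y - y' = (x * y - 1) * y' - (x' * y' - 1) * y - (x - x') * (y * y') by ring.
by apply: dvdOB; [apply: dvdOB|]; apply: dvdOMr => //; exact: inOM.
Qed.

Lemma unit_mod_eqmod q x y : inO y -> dvdO q (x - y) -> unit_mod q x -> unit_mod q y.
Proof.
move=> Oy qxy [Ox [z [Oz xz]]]; split=> //; exists z; split=> //.
have -> : y * z - 1 = (x * z - 1) - (x - y) * z by ring.
by apply: dvdOB => //; exact: dvdOMr.
Qed.

Lemma dvdO_eqtrans q x y z : dvdO q (x - y) -> dvdO q (y - z) -> dvdO q (x - z).
Proof. by move=> xy yz; have -> : x - z = (x - y) + (y - z) by [ring]; exact: dvdOD. Qed.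

(** * Sums over a complete residue system *)

Section ModQ.
Variable q : F.
Hypotheses (Oq : inO q) (q0 : q != 0).

Lemma crs_uniq : uniq (crs_of q).
Proof. by case: (crsP Oq q0). Qed.

Lemma crs_inO x : x \in crs_of q -> inO x.
Proof. by case: (crsP Oq q0) => _ h _ _; exact: h. Qed.

Lemma crs_inj x y : x \in crs_of q -> y \in crs_of q -> dvdO q (x - y) -> x = y.
Proof. by case: (crsP Oq q0) => _ _ h _; exact: h. Qed.

Lemma crs_repr x : inO x -> exists2 y, y \in crs_of q & dvdO q (x - y).
Proof. by case: (crsP Oq q0) => _ _ _; apply. Qed.

Lemma absnorm_gt0 : (0 < absnorm q)%N.
Proof.
have [y + _] := crs_repr (inO0 F).
by rewrite /absnorm; case: (crs_of q).
Qed.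

(** Exactly one member of the system satisfies [P], namely the representative of [a]. *)
Lemma sum_crs_class (V : nmodType) (f : F -> V) a (P : pred F) : inO a ->
  (forall x, x \in crs_of q -> P x <-> dvdO q (x - a)) ->
  (forall x, inO x -> dvdO q (x - a) -> f x = f a) ->
  \sum_(x <- crs_of q | P x) f x = f a.
Proof.
move=> Oa PE fa; rewrite -big_filter -[RHS](big_seq1 +%R).
have mP x : x \in filter P (crs_of q) -> x \in crs_of q /\ dvdO q (x - a).
  by rewrite mem_filter => /andP[Px xr]; split=> //; apply/PE.
apply: (@sum_matching _ _ _ (fun x y => dvdO q (x - y))) => //.
- by rewrite filter_uniq // crs_uniq.
- by move=> x /mP[_ xa]; exists a; rewrite ?mem_head.
- move=> y; rewrite inE => /eqP ->; have [x xr /dvdOBC xa] := crs_repr Oa.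
  by exists x => //; rewrite mem_filter xr andbT; apply/PE.
- move=> x x' y /mP[xr xa] /mP[x'r x'a] _ _ _; apply: crs_inj => //.
  by apply: dvdO_eqtrans xa _; exact: dvdOBC.
- by move=> x y y' _; rewrite !inE => /eqP -> /eqP ->.
- by move=> x y /mP[xr xa]; rewrite inE => /eqP -> _; apply: fa => //; exact: crs_inO.
Qed.

Lemma sum_crs_translate (V : nmodType) (f : F -> V) s : inO s ->
  (forall x y, inO x -> inO y -> dvdO q (x - y) -> f x = f y) ->
  \sum_(x <- crs_of q) f x = \sum_(x <- crs_of q) f (x + s).
Proof.
move=> Os fper; apply: (@sum_matching _ _ _ (fun x y => dvdO q (x - (y + s)))).
- exact: crs_uniq.
- exact: crs_uniq.
- move=> x /crs_inO Ox; have [y yr xy] := crs_repr (inOB Ox Os).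
  by exists y => //; rewrite opprD addrA addrAC.
- move=> y /crs_inO Oy; have [x xr yx] := crs_repr (inOD Oy Os).
  by exists x => //; exact: dvdOBC.
- move=> x x' y xr x'r _ xy /dvdOBC x'y; apply: crs_inj => //.
  exact: dvdO_eqtrans xy x'y.
- move=> x y y' _ yr y'r /dvdOBC xy xy'; apply: crs_inj => //.
  by have -> : y - y' = (y + s) - (y' + s) by [ring]; exact: dvdO_eqtrans xy xy'.
- move=> x y /crs_inO Ox /crs_inO Oy; apply: fper => //; exact: inOD.
Qed.

End ModQ.

(* A finite integral domain is a field. *)
Lemma prime_elt_unit_mod p u : prime_elt p -> inO u -> ~ dvdO p u -> unit_mod p u.
Proof.
move=> [Op p0 p1 pprime] Ou pu; split=> //.
(* [h] picks the representative of an integral element; elsewhere its value 0 is a dummy. *)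
have /choice[h hP] : forall x, exists y, inO x -> y \in crs_of p /\ dvdO p (x - y).
  move=> x; have [Ox|nOx] := pselect (inO x); last by exists 0.
  by have [y] := crs_repr Op p0 Ox; exists y.
have Ocrs := crs_inO Op p0.
pose c := crs_of p; pose c' := [seq h (u * x) | x <- c].
have c'c : {subset c' <= c}.
  by move=> y /mapP[x xc ->]; case: (hP (u * x)) => //; apply: inOM => //; exact: Ocrs.
have uc' : uniq c'.
  rewrite map_inj_in_uniq ?crs_uniq // => x y xc yc hxy; apply: (crs_inj Op p0) => //.
  have [_ ux] := hP _ (inOM Ou (Ocrs _ xc)); have [_ uy] := hP _ (inOM Ou (Ocrs _ yc)).
  have : dvdO p (u * (x - y)).
    by rewrite mulrBr; apply: dvdO_eqtrans ux _; rewrite hxy; exact: dvdOBC.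
  case/pprime => //; exact: inOB (Ocrs _ xc) (Ocrs _ yc).
(* Multiplication by [u] is injective modulo [p], so [c'] is a part of [c] of the same length and
   exhausts it; in particular it hits the class of 1. *)
have [|_ cc'] := uniq_min_size uc' c'c; first by rewrite size_map.
have [h1c h1] := hP 1 (inO1 F).
move: h1c; rewrite -/c -cc' => /mapP[x xc Dx]; exists x; split; first exact: Ocrs.
have [_ ux] := hP _ (inOM Ou (Ocrs _ xc)).
by apply: dvdO_eqtrans ux _; rewrite -Dx; exact: dvdOBC.
Qed.

(** If [v] and [w] invert [u] modulo [p] and [q], then [(u v - 1)(u w - 1) = 1 - u (v + w - u v w)]
    is a multiple of [p q]. *)
Lemma unit_modM p q u : unit_mod p u -> unit_mod q u -> unit_mod (p * q) u.
Proof.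
move=> [Ou [v [Ov [a [Oa pv]]]]] [_ [w [Ow [b [Ob qw]]]]]; split=> //.
exists (v + w - u * (v * w)); split.
  by apply: inOB; [exact: inOD|apply: inOM => //; exact: inOM].
exists (- (a * b)); split; first by apply: inON; exact: inOM.
have -> : u * (v + w - u * (v * w)) - 1 = - ((u * v - 1) * (u * w - 1)) by ring.
by rewrite pv qw; ring.
Qed.

(** Stands in for a greatest common divisor of [t] and the product, which is not automatic in O. By
    induction, a new prime [p] is moved into [d] if it divides [u]; otherwise [u] is invertible
    modulo [p] and [p] is moved into [q']. *)
Lemma prod_primes_gcd (s : seq F) t : (forall p, p \in s -> prime_elt p) -> inO t ->
  exists d q' u, [/\ inO d, inO q', \prod_(p <- s) p = d * q', t = d * u & unit_mod q' u].
Proof.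
move=> + Ot; elim: s => [|p s IH] ps.
  exists 1, 1, t; rewrite big_nil mul1r; split=> //; [exact: inO1..|by rewrite mul1r|].
  (* Modulo 1 every element is invertible, with inverse 0. *)
  split=> //; exists 0; split; first exact: inO0.
  by exists (t * 0 - 1); rewrite mul1r; split=> //; rewrite mulr0 sub0r; apply/inON/inO1.
have [|d [q' [u [Od Oq' Ds Dt uu]]]] := IH; first by move=> x xs; apply: ps; rewrite inE xs orbT.
have pp := ps p (mem_head _ _); have [Op p0 p1 pprime] := pp.
have Ou := unit_mod_inO uu; rewrite big_cons Ds.
have [[u1 [Ou1 Du]]|npu] := pselect (dvdO p u).
  (* If [u = p u1] has inverse [v] modulo [q'], then [p v] is an inverse of [u1]. *)
  exists (p * d), q', u1; split=> //; [exact: inOM|by rewrite mulrA|by rewrite Dt Du; ring|].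
  have [_ [v [Ov uv]]] := uu; split=> //; exists (p * v); split; first exact: inOM.
  by rewrite (_ : u1 * (p * v) = u * v) // Du; ring.
exists d, (p * q'), u; split=> //; [exact: inOM|ring|].
by apply: unit_modM => //; exact: prime_elt_unit_mod.
Qed.

End Residues.

(** * Kloosterman sums *)

Section AdditiveCharacter.
Variables (F : fieldExtType rat) (delta : F).
Hypothesis delta_different : different_generator delta.
Implicit Types a b d q t u v x y z nu mu : F.

(** Were [delta] zero, every element of [F] would have an integral trace; but [1 / (2 n)], with [n]
    the degree of [F], has trace 1/2. *)
Lemma different_generator_neq0 : delta != 0.
Proof.
apply/eqP => D0; have n0 := dim_neq0 F.
have [_ /(_ _ 1)] := delta_different (((\dim {:F})%:R * 2)^-1 *: 1).
rewrite D0 mul0r mulr1 linearZ /= trQ1 invfM mulrAC mulVf // mul1r.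
by move=> /(_ (inO0 F) (inO1 F)).
Qed.

Definition psi q x : complex R := eF (delta^-1 * x / q).

Lemma psiD q x y : psi q (x + y) = psi q x * psi q y.
Proof. by rewrite /psi /eF mulrDr mulrDl linearD expQD. Qed.

Lemma psi_dvd q x : q != 0 -> dvdO q x -> psi q x = 1.
Proof.
move=> q0 [c [Oc ->]]; apply: expQ_int.
rewrite (_ : _ / q = delta^-1 * c); last by field; rewrite q0 different_generator_neq0.
apply: (delta_different delta^-1).2 => //.
rewrite mulfV ?different_generator_neq0 //; exact: inO1.
Qed.

Lemma psi_eqmod q x y : q != 0 -> dvdO q (x - y) -> psi q x = psi q y.
Proof. by move=> q0 xy; rewrite -[x](subrK y) psiD psi_dvd // mul1r. Qed.

(** The hypothesis makes the traces of all [delta^-1 x y / q] integral, so [delta^-1 x / q] lies in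
    the inverse different, which is [delta^-1] O. *)
Lemma psi_primitive q x : q != 0 ->
  (forall y, inO y -> psi q (y * x) = 1) -> dvdO q x.
Proof.
move=> q0 psi1; apply/dvdO_div => //.
have := (delta_different (delta^-1 * x / q)).1.
rewrite -mulrA mulVKf ?different_generator_neq0 //; apply=> y Oy.
apply: expQ_eq1; rewrite -(psi1 y Oy) /psi /eF; congr (expQ (trQ _)); ring.
Qed.

Lemma psi_scale d q x : d != 0 -> q != 0 -> psi (d * q) (d * x) = psi q x.
Proof.
by move=> d0 q0; congr eF; field; rewrite d0 q0 different_generator_neq0.
Qed.

(** Orthogonality: if [q] does not divide [a], primitivity yields an [s] with [psi q (s * a)]
    different from 1, and translating by [s] multiplies the sum by this value. *)
Lemma sum_psi q a : inO q -> q != 0 -> inO a ->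
  \sum_(x <- crs_of q) psi q (x * a) = if `[< dvdO q a >] then (absnorm q)%:R else 0.
Proof.
move=> Oq q0 Oa; have crsO := crs_inO Oq q0; case: asboolP => qa.
  rewrite big_seq (eq_bigr (fun=> 1)) -?big_seq.
    by rewrite big_const_seq count_predT iter_addr addr0.
  by move=> x xr; rewrite psi_dvd //; apply: dvdOMl => //; exact: crsO.
have [s Os psi_s] : exists2 s, inO s & psi q (s * a) != 1.
  apply: contrapT => nos; apply: qa; apply: psi_primitive => // y Oy.
  by apply/eqP/negPn/negP => y1; apply: nos; exists y.
set S := \sum_(x <- _) _.
have : S = S * psi q (s * a).
  rewrite {1}/S (sum_crs_translate Oq q0 Os); last first.
    move=> x y _ _ xy; apply: psi_eqmod => //.
    by rewrite -mulrBl; exact: dvdOMr.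
  by rewrite /S mulr_suml; apply: eq_bigr => x _; rewrite mulrDl psiD.
move/eqP; rewrite -subr_eq0 -{1}[S]mulr1 -mulrBr mulf_eq0 subr_eq0 [1 == _]eq_sym.
by rewrite (negPf psi_s) orbF => /eqP.
Qed.

(** * From Kloosterman sums to fiber sums *)

Section Kloosterman.
Variables (nu mu q : F).
Hypotheses (Onu : inO nu) (Omu : inO mu) (Oq : inO q) (q0 : q != 0).

Let crsO x : x \in crs_of q -> inO x. Proof. exact: crs_inO. Qed.

(** The inner sum has a single term, at the class of the inverse of [x], when [x] is invertible
    modulo [q], and is empty otherwise. In this form [x] and [y] range over the same system and the
    condition can be detected by characters. *)
Lemma kloosterman_pairs : kloosterman (delta^-1 * nu) (delta^-1 * mu) q =
  \sum_(x <- crs_of q) \sum_(y <- crs_of q | `[< dvdO q (x * y - 1) >])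
    psi q (nu * x + mu * y).
Proof.
have [rrs_uniq rrs_unit rrs_inj rrs_repr] := rrsP Oq q0.
pose f x := psi q (nu * x + mu * inv_mod q x).
have fcong x y : unit_mod q x -> unit_mod q y -> dvdO q (x - y) -> f x = f y.
  move=> ux uy xy; apply: psi_eqmod => //.
  have [Oix ix] := inv_modP ux; have [Oiy iy] := inv_modP uy.
  have -> : nu * x + mu * inv_mod q x - (nu * y + mu * inv_mod q y) =
    (x - y) * nu + (inv_mod q x - inv_mod q y) * mu by ring.
  by apply: dvdOD; apply: dvdOMr => //; apply: inv_mod_unique ix iy xy.
transitivity (\sum_(x <- rrs_of q) f x).
  by apply: eq_bigr => x _; rewrite /f /psi; congr eF; ring.
transitivity (\sum_(x <- crs_of q | `[< unit_mod q x >]) f x); last first.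
  rewrite big_mkcond big_seq [RHS]big_seq; apply: eq_bigr => x xr.
  have Ox := crsO xr; case: asboolP => [ux|nux]; last first.
    rewrite big_seq_cond big_pred0 // => y; apply/negP => /andP[yr /asboolP xy].
    by apply: nux; split=> //; exists y; split=> //; exact: crsO.
  have [Oix ix] := inv_modP ux.
  rewrite (@sum_crs_class _ q Oq q0 _ _ (inv_mod q x)) //.
    move=> y yr; have Oy := crsO yr; split=> [/asboolP xy|yi].
      by apply: inv_mod_unique xy ix _ => //; rewrite subrr; exact: dvdO0.
    apply/asboolP; have -> : x * y - 1 = x * (y - inv_mod q x) + (x * inv_mod q x - 1) by ring.
    by apply: dvdOD => //; exact: dvdOMl.
  move=> y Oy yi; apply: psi_eqmod => //.
  by rewrite opprD addrACA subrr add0r -mulrBr; exact: dvdOMl.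
rewrite -[RHS]big_filter; apply: (@sum_matching _ _ _ (fun x y => dvdO q (x - y))) => //.
- by rewrite filter_uniq // crs_uniq.
- move=> x /rrs_unit ux; have [y yr xy] := crs_repr Oq q0 (unit_mod_inO ux).
  by exists y => //; rewrite mem_filter yr andbT; apply/asboolP/(unit_mod_eqmod (crsO yr) xy).
- move=> y; rewrite mem_filter => /andP[/asboolP uy yr].
  by have [x xr /dvdOBC yx] := rrs_repr y uy; exists x.
- move=> x x' y xr x'r _ xy /dvdOBC x'y; apply: rrs_inj => //; exact: dvdO_eqtrans xy x'y.
- move=> x y y' _; rewrite !mem_filter => /andP[_ yr] /andP[_ y'r] /dvdOBC xy xy'.
  by apply: (crs_inj Oq q0) => //; exact: dvdO_eqtrans xy xy'.
- move=> x y /rrs_unit ux; rewrite mem_filter => /andP[/asboolP uy yr]; exact: fcong.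
Qed.

(** This is [G(t)]; the condition on [y] is what survives from the sum of [psi q (x * (nu - t * y))]
    over [x]. *)
Definition fiber_sum t : complex R :=
  \sum_(y <- crs_of q | `[< dvdO q (nu - t * y) >]) psi q (mu * y + t).

(* Detect [x y = 1] by the characters [t |-> psi (t (1 - x y))], then sum over [x] first. *)
Lemma kloosterman_fiber_sum : kloosterman (delta^-1 * nu) (delta^-1 * mu) q =
  \sum_(t <- crs_of q) fiber_sum t.
Proof.
have N0 : (absnorm q)%:R != 0 :> complex R by rewrite pnatr_eq0 -lt0n absnorm_gt0.
(* Each detection of a congruence by characters produces the factor [absnorm q], so both sides are
   first multiplied by it. *)
apply: (mulIf N0); rewrite kloosterman_pairs !mulr_suml.
transitivity (\sum_(x <- crs_of q) \sum_(y <- crs_of q) \sum_(t <- crs_of q)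
    psi q (mu * y + t) * psi q (x * (nu - t * y))).
  rewrite !big_seq; apply: eq_bigr => x /crsO Ox.
  rewrite mulr_suml big_mkcond !big_seq; apply: eq_bigr => y /crsO Oy.
  (* The exchange rests on [mu y + t + x (nu - t y) = nu x + mu y + t (1 - x y)]. *)
  have -> : \sum_(t <- crs_of q) psi q (mu * y + t) * psi q (x * (nu - t * y)) =
      psi q (nu * x + mu * y) * \sum_(t <- crs_of q) psi q (t * (1 - x * y)).
    rewrite mulr_sumr; apply: eq_bigr => t _; rewrite -!psiD; congr psi; ring.
  rewrite sum_psi //; last by apply: inOB; [exact: inO1|exact: inOM].
  rewrite (_ : `[< dvdO q (1 - _) >] = `[< dvdO q (x * y - 1) >]).
    by case: ifP; rewrite ?mulr0.
  by apply: asbool_equiv_eq; split; exact: dvdOBC.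
under eq_bigr do rewrite exchange_big.
rewrite exchange_big !big_seq; apply: eq_bigr => t /crsO Ot.
rewrite exchange_big /fiber_sum mulr_suml [RHS]big_mkcond !big_seq.
apply: eq_bigr => y /crsO Oy.
rewrite -mulr_sumr sum_psi //; last by apply: inOB => //; exact: inOM.
by case: ifP; rewrite ?mulr0.
Qed.

Lemma fiber_sum_eqmod t t' : dvdO q (t - t') -> fiber_sum t = fiber_sum t'.
Proof.
move=> tt'; rewrite /fiber_sum big_mkcond [RHS]big_mkcond !big_seq.
apply: eq_bigr => y /crsO Oy.
have tty : dvdO q (t * y - t' * y) by rewrite -mulrBl; exact: dvdOMr.
have -> : `[< dvdO q (nu - t * y) >] = `[< dvdO q (nu - t' * y) >].
  by apply: asbool_equiv_eq; split=> h; apply: dvdO_eqtrans h _ => //; exact: dvdOBC.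
case: ifP => // _; apply: psi_eqmod => //.
by rewrite opprD addrACA subrr add0r.
Qed.

End Kloosterman.

(* The substitution [y = v nu' + q' z] with [z] modulo [d] solves the congruence
   defining the fiber sum. *)
Lemma fiber_sum_unit nu mu d q q' u v : inO nu -> inO mu -> inO d -> inO q' -> q != 0 ->
  q = d * q' -> inO u -> inO v -> dvdO q' (u * v - 1) ->
  fiber_sum nu mu q (d * u) =
  if `[< dvdO d nu >] && `[< dvdO d mu >] then
    (absnorm d)%:R * psi q' (u + nu * mu / d ^+ 2 * v) else 0.
Proof.
move=> Onu Omu Od Oq' q0 Dq Ou Ov uv.
have Oq : inO q by rewrite Dq; exact: inOM.
have /norP[d0 q'0] : ~~ ((d == 0) || (q' == 0)) by rewrite -mulf_eq0 -Dq.
case: asboolP => [[nu' [Onu' Dnu]]|dnu] /=; last first.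
  rewrite /fiber_sum big_seq_cond big_pred0 // => y; apply/negP => /andP[yr /asboolP].
  rewrite Dq => h; apply: dnu; rewrite -[nu](subrK (d * u * y)).
  apply: dvdOD; first by apply: dvdO_trans h; exact: dvdO_mulr.
  by rewrite -mulrA; apply/dvdO_mulr/inOM => //; exact: crs_inO yr.
transitivity (\sum_(z <- crs_of d) psi q (mu * (v * nu' + q' * z) + d * u)).
  rewrite /fiber_sum -big_filter.
  (* After division by [d] the congruence reads [u x = nu'] modulo [q'], and [v] inverts [u]. *)
  have eqv x : inO x -> dvdO q (nu - d * u * x) <-> dvdO q' (x - v * nu').
    move=> Ox; have -> : nu - d * u * x = d * (nu' - u * x) by rewrite Dnu; ring.
    rewrite {1}Dq dvdO_mul2l //; split=> h.
      have -> : x - v * nu' = - ((u * v - 1) * x) - (nu' - u * x) * v by ring.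
      by apply: dvdOB; [apply: dvdON|]; exact: dvdOMr.
    have -> : nu' - u * x = - ((u * v - 1) * nu') - (x - v * nu') * u by ring.
    by apply: dvdOB; [apply: dvdON|]; exact: dvdOMr.
  apply: (@sum_matching _ _ _ (fun y z => dvdO q (y - (v * nu' + q' * z)))).
  - by rewrite filter_uniq // crs_uniq.
  - exact: crs_uniq.
  - move=> y; rewrite mem_filter => /andP[/asboolP + yr].
    case/(eqv _ (crs_inO Oq q0 yr)) => w [Ow Dw]; have [z zr wz] := crs_repr Od d0 Ow.
    exists z => //; rewrite opprD addrA Dw -mulrBr Dq [d * _]mulrC.
    exact/dvdO_mul2l.
  - move=> z zr; have Oz := crs_inO Od d0 zr.
    have Ovz : inO (v * nu' + q' * z) by apply: inOD; exact: inOM.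
    have [y yr /dvdOBC yvz] := crs_repr Oq q0 Ovz.
    exists y => //; rewrite mem_filter yr andbT; apply/asboolP/eqv; first exact: crs_inO yr.
    have -> : y - v * nu' = (y - (v * nu' + q' * z)) + q' * z by ring.
    apply: dvdOD; last exact: dvdO_mulr.
    by apply: dvdO_trans yvz; rewrite Dq; exact: dvdO_mull.
  - move=> y y' z; rewrite !mem_filter => /andP[_ yr] /andP[_ y'r] _ yz /dvdOBC y'z.
    apply: (crs_inj Oq q0) => //; exact: dvdO_eqtrans yz y'z.
  - move=> y z z' _ zr z'r /dvdOBC yz yz'; apply: (crs_inj Od d0) => //.
    apply/(@dvdO_mul2l _ q') => //; rewrite [q' * d]mulrC -Dq.
    have -> : q' * (z - z') = (v * nu' + q' * z) - (v * nu' + q' * z') by ring.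
    exact: dvdO_eqtrans yz yz'.
  - move=> y z _ _ yz; apply: psi_eqmod => //.
    by rewrite opprD addrACA subrr addr0 -mulrBr; exact: dvdOMl.
(* As [q = d q'], the part depending on [z] is [psi q (q' * (mu * z)) = psi d (mu * z)], and its sum
   decides whether [d] divides [mu]. *)
have -> : \sum_(z <- crs_of d) psi q (mu * (v * nu' + q' * z) + d * u) =
    psi q (mu * (v * nu') + d * u) * \sum_(z <- crs_of d) psi d (z * mu).
  rewrite mulr_sumr; apply: eq_bigr => z _.
  rewrite -(psi_scale _ q'0 d0) [q' * d]mulrC -Dq -psiD; congr psi; ring.
rewrite sum_psi //; case: asboolP => [[mu' [_ Dmu]]|_]; last by rewrite mulr0.
(* With [mu = d mu'] the argument is [d (u + nu' mu' v)], and [d] cancels against the modulus. *)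
rewrite mulrC; congr (_ * _); rewrite Dq -(psi_scale _ d0 q'0); congr psi.
by rewrite Dmu Dnu; field.
Qed.

(** A pair [(d, u)], with [d] a common divisor and [u] in a reduced system modulo [q / d], is
    matched with the residue [t = d u] modulo [q]. Different pairs give different residues, and the
    fiber sum vanishes at residues that come from no pair. For fixed [d] the fiber sums add up to
    the summand of [d]. *)
Theorem selberg_identity (q nu mu : F) (s : seq F) :
  (forall p, p \in s -> prime_elt p) -> q = \prod_(p <- s) p -> inO nu -> inO mu ->
  kloosterman (delta^-1 * nu) (delta^-1 * mu) q =
  \sum_(d <- common_divs nu mu q)
     (absnorm d)%:R * kloosterman delta^-1 (delta^-1 * (nu * mu / d ^+ 2)) (q / d).
Proof.
move=> s_prime Dq Onu Omu.
have [Oq q0] : inO q /\ q != 0.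
  rewrite Dq; split.
    by rewrite big_seq; elim/big_ind: _ => [||p /s_prime[]] //; [exact: inO1|exact: inOM].
  by rewrite prodf_seq_neq0; apply/allP => p /s_prime[].
have [D_uniq Ddiv D_inj D_repr] := common_divsP nu mu Oq q0.
set D := common_divs nu mu q in D_uniq Ddiv D_inj D_repr *.
have qdP d : inO d -> dvdO d q ->
    [/\ d != 0, inO (q / d), q / d != 0 & q = d * (q / d)].
  move=> Od dq; have d0 : d != 0.
    by apply: contraNneq q0 => d0; case: dq => c [_ ->]; rewrite d0 mul0r.
  by split; [|exact/dvdO_div|rewrite mulf_neq0 ?invr_eq0|rewrite mulrC divfK].
have Drrs d u : d \in D -> u \in rrs_of (q / d) -> unit_mod (q / d) u.
  move=> /Ddiv[Od _ _ dq]; have [_ Oqd qd0 _] := qdP d Od dq.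
  by case: (rrsP Oqd qd0) => _ + _ _; apply.
pose r' := [seq (d, u) | d <- D, u <- rrs_of (q / d)].
have mr' d u : (d, u) \in r' -> d \in D /\ u \in rrs_of (q / d).
  by case/allpairsPdep => d1 [u1 [dD ur [-> ->]]].
rewrite (kloosterman_fiber_sum Onu Omu Oq q0).
transitivity (\sum_(w <- r') fiber_sum nu mu q (w.1 * w.2)); last first.
  rewrite big_allpairs_dep big_seq [RHS]big_seq; apply: eq_bigr => d dD.
  have [Od dnu dmu dq] := Ddiv d dD; have [d0 Oqd qd0 qE] := qdP d Od dq.
  rewrite mulr_sumr big_seq [RHS]big_seq; apply: eq_bigr => u ur.
  have uu := Drrs d u dD ur; have [Oiu iu] := inv_modP uu.
  rewrite (fiber_sum_unit Onu Omu Od Oqd q0 qE (unit_mod_inO uu) Oiu iu).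
  rewrite !asboolT //=; congr (_ * _); congr eF; ring.
pose P t := `[< exists w, w \in r' /\ dvdO q (t - w.1 * w.2) >].
have notP t : t \in crs_of q -> ~~ P t -> fiber_sum nu mu q t = 0.
  move=> tr /asboolP nPt; have Ot := crs_inO Oq q0 tr.
  have [d [q' [u [Od Oq' Dqd Dt uu]]]] := prod_primes_gcd s_prime Ot.
  move: Dqd; rewrite -Dq => Dqd.
  have [_ [v [Ov uv]]] := uu.
  rewrite Dt (fiber_sum_unit Onu Omu Od Oq' q0 Dqd (unit_mod_inO uu) Ov uv).
  (* A nonzero fiber sum requires [d] to divide both [nu] and [mu]. Replacing [d] by its associate
     [d'] in [D] multiplies [u] by a unit [e], so [t] comes from a pair after all. *)
  case: asboolP => //= dnu; case: asboolP => //= dmu; case: nPt.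
  have dq : dvdO d q by rewrite Dqd; exact: dvdO_mulr.
  have [d' d'D [dd' d'd]] := D_repr d Od dnu dmu dq.
  have [Od' _ _ d'q] := Ddiv d' d'D; have [d'0 Oqd' qd'0 qE] := qdP d' Od' d'q.
  have [e [Oe De]] := d'd; have [e' [Oe' De']] := dd'.
  have ee' : e * e' = 1 by apply: (mulfI d'0); rewrite mulrA -De -De' mulr1.
  have qd'E : q / d' = e * q' by apply: (mulfI d'0); rewrite -qE Dqd De mulrA.
  have ueu : unit_mod (q / d') (e * u).
    split; first exact: inOM (unit_mod_inO uu).
    exists (e' * v); split; first exact: inOM.
    have -> : e * u * (e' * v) - 1 = u * v - 1 by rewrite mulrACA ee' mul1r.
    by apply: dvdO_trans uv; exists e'; split=> //; rewrite qd'E mulrAC ee' mul1r.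
  have [_ _ _ /(_ _ ueu)[u' u'r euu']] := rrsP Oqd' qd'0.
  exists (d', u'); split; first by apply/allpairsPdep; exists d', u'.
  by rewrite /= Dt De -mulrA -mulrBr {1}qE dvdO_mul2l.
(* As [d] divides [q], it divides [d' u']; and [d'] is congruent to [d' u' v'] modulo [q] when [v']
   inverts [u'] modulo [q / d']. *)
have r'_dvd d u d' u' : (d, u) \in r' -> (d', u') \in r' ->
    dvdO q (d * u - d' * u') -> dvdO d d'.
  move=> /mr'[dD ur] /mr'[d'D u'r] h.
  have [Od _ _ dq] := Ddiv d dD; have [Od' _ _ d'q] := Ddiv d' d'D.
  have [d'0 Oqd' qd'0 qE] := qdP d' Od' d'q.
  have [_ [v' [Ov' uv']]] := Drrs _ _ d'D u'r.
  have -> : d' = (d * u - (d * u - d' * u')) * v' - d' * (u' * v' - 1) by ring.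
  apply: dvdOB; last by apply: dvdO_trans dq _; rewrite {1}qE dvdO_mul2l.
  apply: dvdOMr => //; apply: dvdOB; last exact: dvdO_trans h.
  exact/dvdO_mulr/unit_mod_inO/(Drrs d u).
transitivity (\sum_(t <- crs_of q | P t) fiber_sum nu mu q t).
  rewrite [RHS]big_mkcond !big_seq; apply: eq_bigr => t tr.
  by case: ifPn => // /(notP _ tr).
rewrite -big_filter.
apply: (@sum_matching _ _ _ (fun t w => dvdO q (t - w.1 * w.2))).
- by rewrite filter_uniq // crs_uniq.
- apply: allpairs_uniq_dep => // [d dD|[d u] [d' u'] _ _ /= [-> ->]] //.
  have [Od _ _ dq] := Ddiv d dD; have [_ Oqd qd0 _] := qdP d Od dq.
  by case: (rrsP Oqd qd0).
- by move=> t; rewrite mem_filter => /andP[/asboolP[w [wr' tw]] _]; exists w.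
- move=> [d u] dur'; have [dD ur] := mr' _ _ dur'.
  have [Od _ _ _] := Ddiv d dD.
  have [t tr /dvdOBC td] := crs_repr Oq q0 (inOM Od (unit_mod_inO (Drrs _ _ dD ur))).
  by exists t => //; rewrite mem_filter tr andbT; apply/asboolP; exists (d, u).
- move=> t t' w; rewrite !mem_filter => /andP[_ tr] /andP[_ t'r] _ tw /dvdOBC t'w.
  by apply: (crs_inj Oq q0) => //; exact: dvdO_eqtrans tw t'w.
- move=> t [d u] [d' u'] _ dur' du'r' /dvdOBC /= tw tw'.
  have h := dvdO_eqtrans tw tw'; have h' := dvdOBC h.
  have [[dD ur] [d'D u'r]] := (mr' _ _ dur', mr' _ _ du'r').
  (* Each of [d] and [d'] divides the other, and [D] has only one generator of each ideal. *)
  have dd' : d = d' by apply: D_inj; [| |exact: r'_dvd h|exact: r'_dvd h'].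
  rewrite -{}dd' {d'D} in u'r h *.
  have [Od _ _ dq] := Ddiv d dD; have [d0 Oqd qd0 qE] := qdP d Od dq.
  congr (_, _); case: (rrsP Oqd qd0) => _ _ + _; apply=> //.
  by apply/(dvdO_mul2l _ _ d0); rewrite -qE mulrBr.
- by move=> t w _ _; exact: fiber_sum_eqmod.
Qed.

End AdditiveCharacter.

Theorem theorem4p2 (F : fieldExtType rat) (delta q nu mu : F) :
  totally_real F ->
  different_generator delta ->
  (exists s : seq F, s != [::] /\ (forall p, p \in s -> prime_elt p) /\
                     q = \prod_(p <- s) p) ->
  inO nu -> inO mu ->
  kloosterman (delta^-1 * nu) (delta^-1 * mu) q =
  \sum_(d <- common_divs nu mu q)
     (absnorm d)%:R * kloosterman delta^-1 (delta^-1 * (nu * mu / d ^+ 2)) (q / d).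
Proof.
move=> _ delta_different [s [_ [s_prime Dq]]] Onu Omu.
exact: (@selberg_identity F delta delta_different q nu mu s).
Qed.
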